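(* Let $s\ge 3$ be an integer. There is no $[s^2,s;3]$-bigraph whose order attains the Moore bound $M(s^2,s;3)=(s^2-1)+(s^3-s)$. Instead, the following improved Moore bound holds: every $[s^2,s;3]$-bigraph has at most $$M^*(s^2,s;3)=(s^2-2)(s+1)$$ vertices, this value corresponding to part sizes $N_1=s^2-2$ and $N_2=s^3-2s$.
   Context: Graphs are finite and simple. An $[r,s;d]$-bigraph is a bipartite graph $G=(V,E)$ with stable sets (parts) $V=V_1\cup V_2$, in which every vertex of $V_1$ has degree $r$, every vertex of $V_2$ has degree $s$, and the diameter is $d$. Write $N_i=|V_i|$ for $i=1,2$; the order of $G$ is $N_1+N_2$. For $r\ge s$, the Moore bound for diameter $3$ is $$M(r,s;3)=\left\lfloor \frac{1+s(r-1)}{\rho}\right\rfloor(\rho+\sigma),\qquad \rho=\frac{r}{\gcd(r,s)},\quad \sigma=\frac{s}{\gcd(r,s)},$$ which is an upper bound on the order of any $[r,s;3]$-bigraph. For $r=s^2$ it equals $(s^2-1)+(s^3-s)$, corresponding to $N_1=s^2-1$, $N_2=s^3-s$. The improved bound is an upper bound; no claim is made that it is attained. *)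

(* Defs.v *)
From mathcomp Require Import all_boot.

Set Implicit Arguments.
Unset Strict Implicit.
Unset Printing Implicit Defensive.

(* A finite simple graph is a symmetric irreflexive relation [e] on a finite
   type [T] of vertices. *)

Definition degree (T : finType) (e : rel T) (x : T) : nat :=
  #|[set y | e x y]|.

Definition has_walk (T : finType) (e : rel T) (x y : T) (k : nat) : bool :=
  [exists p : k.-tuple T, path e x p && (last x p == y)].

(* Two vertices in the same component are at distance < #|T|, so the search
   below is exhaustive; it returns the junk value #|T| exactly when [y] is not
   reachable from [x], a case excluded in [has_diameter]. *)
Definition dist (T : finType) (e : rel T) (x y : T) : nat :=
  find (has_walk e x y) (iota 0 #|T|).

Definition has_diameter (T : finType) (e : rel T) (d : nat) : Prop :=
  (forall x y : T, connect e x y) /\ \max_(x : T) \max_(y : T) dist e x y = d.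

Record is_bigraph (T : finType) (e : rel T) (V1 V2 : {set T}) (r s d : nat) :
    Prop := IsBigraph {
  bigraph_sym : symmetric e;
  bigraph_irrefl : irreflexive e;
  bigraph_cover : V1 :|: V2 = [set: T];
  bigraph_disjoint : [disjoint V1 & V2];
  bigraph_stable1 : {in V1 &, forall x y, ~~ e x y};
  bigraph_stable2 : {in V2 &, forall x y, ~~ e x y};
  bigraph_degree1 : {in V1, forall x, degree e x = r};
  bigraph_degree2 : {in V2, forall x, degree e x = s};
  bigraph_diameter : has_diameter e d
}.

(* The Moore bound M(r, s; 3), meant for [s <= r]. *)
Definition moore_bound3 (r s : nat) : nat :=
  let rho := r %/ gcdn r s in
  let sigma := s %/ gcdn r s in
  (1 + s * (r - 1)) %/ rho * (rho + sigma).

Definition improved_moore_bound3 (s : nat) : nat := (s ^ 2 - 2) * (s + 1).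

(* Main.v *)
Require Import Defs.
From mathcomp Require Import all_boot.
From mathcomp Require Import zify.

Set Implicit Arguments.
Unset Strict Implicit.
Unset Printing Implicit Defensive.

(** View [V1] as points and [V2] as blocks: a point lies on [s ^ 2] blocks, a
    block has [s] points, and diameter 3 forces any two blocks to meet. Counting
    the incidences along one block gives [#|V2| <= s ^ 3 - s + 1], and
    [#|V2| = s * #|V1|], so [#|V1| <= s ^ 2 - 1]. If [#|V1| = s ^ 2 - 1], every
    block meets exactly one other block in 2 points and all the others in 1
    point. This determines the sum of the squares of the block intersection
    sizes, i.e. the trace of the square of the Gram matrix of the incidence
    matrix; on the point side the same trace is bounded below by Cauchy-Schwarz,
    and the two values are incompatible for [s >= 3]. *)

(** * Gram matrix of an incidence relation *)

Definition joint (T : finType) (I : T -> T -> bool) (P : {set T}) (b c : T) :=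
  \sum_(x in P) I x b * I x c.

(** Flags [(x, c)] with [x] on [b] are counted from the point side. The relation is a parameter, so
    flipping [I] and exchanging [P] with [B] gives the dual count. *)
Lemma sum_joint (T : finType) (I : T -> T -> bool) (P B : {set T}) (k r : nat)
    (b : T) :
  \sum_(x in P) I x b = k ->
  {in P, forall x, \sum_(c in B) I x c = r} ->
  \sum_(c in B) joint I P b c = k * r.
Proof.
move=> <- Pr; rewrite /joint exchange_big big_distrl /=.
by apply: eq_bigr => x xP; rewrite -big_distrr /= Pr.
Qed.

Lemma jointxx (T : finType) (I : T -> T -> bool) (P : {set T}) (b : T) :
  joint I P b b = \sum_(x in P) I x b.
Proof. by apply: eq_bigr => x _; rewrite mulnb andbb. Qed.

(* [tr ((M^T M)^2) = tr ((M M^T)^2)] for the incidence matrix [M]. *)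
Lemma sum_joint_sq (T : finType) (I : T -> T -> bool) (P B : {set T}) :
  \sum_(b in B) \sum_(c in B) joint I P b c ^ 2 =
  \sum_(x in P) \sum_(y in P) joint (fun b x => I x b) B x y ^ 2.
Proof.
have E b c : joint I P b c ^ 2 =
    \sum_(x in P) \sum_(y in P) I x b * I x c * (I y b * I y c).
  rewrite -mulnn {1}/joint big_distrl /=.
  by apply: eq_bigr => x _; rewrite /joint big_distrr.
have F x y : joint (fun b x => I x b) B x y ^ 2 =
    \sum_(b in B) \sum_(c in B) I x b * I y b * (I x c * I y c).
  rewrite -mulnn {1}/joint big_distrl /=.
  by apply: eq_bigr => b _; rewrite /joint big_distrr.
under eq_bigr => b _ do under eq_bigr => c _ do rewrite E.
under [RHS]eq_bigr => x _ do under eq_bigr => y _ do rewrite F.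
under eq_bigr => b _.
  rewrite exchange_big /=.
  under eq_bigr => x _ do rewrite exchange_big /=.
  over.
rewrite exchange_big /=; apply: eq_bigr => x _.
rewrite exchange_big /=; apply: eq_bigr => y _.
by apply: eq_bigr => b _; apply: eq_bigr => c _; rewrite mulnACA.
Qed.

(** * Designs in which any two blocks meet *)

Section IntersectingBlocks.

Variables (T : finType) (I : T -> T -> bool) (P B : {set T}) (s : nat).
Hypothesis point_degree : {in P, forall x, \sum_(b in B) I x b = s ^ 2}.
Hypothesis block_size : {in B, forall b, \sum_(x in P) I x b = s}.
Hypothesis blocks_meet :
  {in B &, forall b c, b != c -> exists2 x, x \in P & I x b && I x c}.

Lemma card_blocks : 0 < s -> #|B| = s * #|P|.
Proof.
move=> s_gt0; apply/eqP; rewrite -(eqn_pmul2r s_gt0) -sum_nat_const.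
rewrite -(eq_bigr _ block_size) exchange_big /= (eq_bigr _ point_degree).
by rewrite sum_nat_const mulnAC mulnn mulnC.
Qed.

Lemma joint_gt0 : {in B &, forall b c, b != c -> 0 < joint I P b c}.
Proof.
move=> b c bB cB /(blocks_meet bB cB)[x xP /andP[xb xc]].
by rewrite /joint (bigD1 x) //= xb xc.
Qed.

Lemma sum_joint_others :
  {in B, forall b, s + \sum_(c in B :\ b) joint I P b c = s ^ 3}.
Proof.
move=> b bB; rewrite [s ^ 3]expnS -(sum_joint (block_size bB) point_degree).
by rewrite (big_setD1 b bB) /= jointxx block_size.
Qed.

Lemma card_blocks_ub b : b \in B -> s + #|B| <= (s ^ 3).+1.
Proof.
move=> bB; rewrite (cardsD1 b) bB addnCA add1n ltnS -(sum_joint_others bB).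
rewrite leq_add2l -sum1_card leq_sum // => c; rewrite !inE => /andP[cb cB].
by rewrite joint_gt0 // eq_sym.
Qed.

(* The intersections exceed 1 by a total of 1, so each is 1 or 2, where
   [m ^ 2 + 2 = 3 * m]. *)
Lemma sum_joint_sq_ub b : b \in B -> s + #|B| = s ^ 3 ->
  \sum_(c in B) joint I P b c ^ 2 + s <= s ^ 3 + s ^ 2 + 2.
Proof.
move=> bB cardB; have sumJ := sum_joint_others bB.
have J_gt0 c : c \in B :\ b -> 0 < joint I P b c.
  by rewrite !inE => /andP[cb cB]; rewrite joint_gt0 // eq_sym.
have cardBb : (#|B :\ b|).+1 = #|B| by rewrite (cardsD1 b B) bB.
have J_le2 c : c \in B :\ b -> joint I P b c <= 2.
  move=> cB; have: #|B :\ b :\ c| <= \sum_(d in B :\ b :\ c) joint I P b d.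
    by rewrite -sum1_card leq_sum // => d /setD1P[_ /J_gt0].
  have := cardsD1 c (B :\ b); rewrite cB.
  by move: sumJ cardBb; rewrite (big_setD1 c cB) /=; lia.
have: \sum_(c in B :\ b) (joint I P b c ^ 2 + 2) <=
      \sum_(c in B :\ b) 3 * joint I P b c.
  apply: leq_sum => c cB.
  by have := J_gt0 c cB; case: joint (J_le2 c cB) => [|[|[|]]].
rewrite big_split -big_distrr /= sum_nat_const (big_setD1 b bB) /=.
by rewrite jointxx block_size //; lia.
Qed.

(** Termwise [2 * (s - 1) * m <= m ^ 2 + (s - 1) ^ 2], summed over [y != x]. In the critical case
    [#|P| = s ^ 2 - 1], the constant [s - 1] is the integer part of the average of [m]. *)
Lemma sum_joint_dual_sq_lb x : 0 < s -> x \in P ->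
  s ^ 4 + 2 * (s - 1) * (s ^ 3 - s ^ 2) <=
  \sum_(y in P) joint (fun b x => I x b) B x y ^ 2 + #|P :\ x| * (s - 1) ^ 2.
Proof.
move=> s_gt0 xP; have Jxx : joint (fun b x => I x b) B x x = s ^ 2.
  by rewrite jointxx point_degree.
have := sum_joint (point_degree xP) block_size.
rewrite (big_setD1 x xP) /= Jxx (big_setD1 x xP) /= Jxx -expnM -expnSr => sumJ.
rewrite -addnA leq_add2l -sumJ addKn big_distrr -sum_nat_const -big_split /=.
apply: leq_sum => y _; rewrite -mulnA [_ * joint _ _ _ _]mulnC.
exact: nat_Cauchy.
Qed.

Lemma card_points_intersecting_ub : 2 < s -> #|P| <= s ^ 2 - 2.
Proof.
move=> s_gt2; have s_gt0 : 0 < s by lia.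
have cardB := card_blocks s_gt0.
rewrite leqNgt; apply/negP => P_big.
have [b bB] : exists b, b \in B by apply/card_gt0P; rewrite cardB; nia.
(* The bound [s + s * n <= s ^ 3 + 1] yields [n + 1 <= s ^ 2] because [1 < s]; [P_big] gives the
   converse. *)
have P_sq : #|P|.+1 = s ^ 2.
  have := card_blocks_ub bB; rewrite cardB; move: P_big.
  move: #|P| => n; rewrite !expnS expn0; nia.
have cardBs : s + #|B| = s ^ 3 by rewrite cardB -mulnS P_sq -expnS.
have ub : \sum_(b in B) \sum_(c in B) joint I P b c ^ 2 + #|B| * s <=
          #|B| * (s ^ 3 + s ^ 2 + 2).
  rewrite -!sum_nat_const -big_split /=; apply: leq_sum => c cB.
  exact: sum_joint_sq_ub.
have lb : #|P| * (s ^ 4 + 2 * (s - 1) * (s ^ 3 - s ^ 2)) <=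
    \sum_(x in P) \sum_(y in P) joint (fun b x => I x b) B x y ^ 2 +
    #|P| * (#|P|.-1 * (s - 1) ^ 2).
  rewrite -!sum_nat_const -big_split /=; apply: leq_sum => x xP.
  by rewrite [#|P|](cardsD1 x) xP; apply: sum_joint_dual_sq_lb.
have: #|P| * (s ^ 4 + 2 * (s - 1) * (s ^ 3 - s ^ 2)) + #|P| * (s * s) <=
      #|P| * (s * (s ^ 3 + s ^ 2 + 2)) + #|P| * (#|P|.-1 * (s - 1) ^ 2).
  move: ub lb; rewrite sum_joint_sq cardB; lia.
rewrite -!mulnDr leq_pmul2l; last by lia.
have -> : #|P|.-1 = s ^ 2 - 2 by lia.
case: s s_gt2 => [|[|[|k]]] // _.
have -> : k.+3 - 1 = k.+2 by lia.
have -> : k.+3 ^ 2 - 2 = k ^ 2 + 6 * k + 7 by rewrite -!mulnn; lia.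
have -> : k.+3 ^ 3 - k.+3 ^ 2 = k.+3 ^ 2 * k.+2.
  by rewrite (expnS _ 2) mulSn addKn mulnC.
rewrite !expnS !expn0 !muln1.
(* With [s = k + 3], the left side exceeds the right by [k ^ 4 + 9 * k ^ 3 + 31 * k ^ 2 + 45 * k +
   20]; the monomials are atoms for [lia]. *)
have := leq0n (k * k); have := leq0n (k * (k * k)).
have := leq0n (k * (k * (k * k))).
lia.
Qed.

End IntersectingBlocks.

(** * From bigraphs of diameter 3 to intersecting blocks *)

Lemma degree_sum (T : finType) (e : rel T) (A B : {set T}) (x : T) :
  A :|: B = [set: T] -> {in A, forall y, ~~ e x y} ->
  \sum_(y in B) e x y = degree e x.
Proof.
move=> AB eA; rewrite /degree -sum1_card [LHS]big_mkcond [RHS]big_mkcond.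
apply: eq_bigr => y _; rewrite inE; case: ifP => [_|yB]; first by case: (e x y).
have : y \in A by move/setP/(_ y): AB; rewrite !inE yB orbF.
by move=> /eA/negbTE->.
Qed.

Lemma dist_has_walk (T : finType) (e : rel T) (x y : T) :
  dist e x y < #|T| -> has_walk e x y (dist e x y).
Proof.
move=> d_lt; have : has (has_walk e x y) (iota 0 #|T|).
  by rewrite has_find size_iota.
by move/(nth_find 0); rewrite nth_iota.
Qed.

Lemma diameter_dist (T : finType) (e : rel T) (d : nat) (x y : T) :
  has_diameter e d -> dist e x y <= d.
Proof.
move=> [_ <-]; apply: leq_trans (leq_bigmax x).
exact: (@leq_bigmax _ (fun y => dist e x y) y).
Qed.

Section Bigraph.

Variables (T : finType) (e : rel T) (V1 V2 : {set T}) (r s : nat).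
Hypothesis G : is_bigraph e V1 V2 r s 3.

Lemma bigraph_nbr2 x y : x \in V2 -> e x y -> y \in V1.
Proof.
move=> xV exy; have /setP/(_ y) := bigraph_cover G.
rewrite !inE => /orP[] // yV.
by have := bigraph_stable2 G xV yV; rewrite exy.
Qed.

Lemma bigraph_nbr1 x y : x \in V1 -> e x y -> y \in V2.
Proof.
move=> xV exy; have /setP/(_ y) := bigraph_cover G.
rewrite !inE => /orP[] // yV.
by have := bigraph_stable1 G xV yV; rewrite exy.
Qed.

Lemma bigraph_card : #|T| = #|V1| + #|V2|.
Proof.
rewrite -cardsT -(bigraph_cover G) cardsU.
by have := bigraph_disjoint G; rewrite -setI_eq0 => /eqP->; rewrite cards0 subn0.
Qed.

(** Walks inside one part have even length, so a walk of length at most 3 between distinct blocks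
    has length 2, and its middle vertex is the common point. *)
Lemma bigraph_common_nbr : 2 < s ->
  {in V2 &, forall b c, b != c -> exists2 x, x \in V1 & e x b && e x c}.
Proof.
move=> s_gt2 b c bV cV bc.
(* A value of [dist] is a true walk length only below [#|T|]; [b] and its [s] neighbours already
   give four vertices. *)
have T_gt3 : 3 < #|T|.
  have bN : b \notin [set y | e b y] by rewrite inE (bigraph_irrefl G).
  have := max_card (mem (b |: [set y | e b y])); rewrite cardsU1 bN.
  by have := bigraph_degree2 G bV; rewrite /degree; lia.
have d_le3 : dist e b c <= 3 := diameter_dist b c (bigraph_diameter G).
have /existsP[p] := dist_has_walk (leq_ltn_trans d_le3 T_gt3).
move: (size_tuple p) d_le3; case: (tval p) => [|x [|y [|z [|t q]]]] /= <- // _.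
- by rewrite (negbTE bc).
- by rewrite andbT => /andP[ebx /eqP xc];
    have := bigraph_stable2 G bV cV; rewrite -xc ebx.
- case/andP=> /and3P[ebx exy _] /eqP <-; exists x; first exact: bigraph_nbr2 ebx.
  by rewrite (bigraph_sym G) ebx.
case/andP=> /and4P[ebx exy eyz _] /eqP zc.
have yV := bigraph_nbr1 (bigraph_nbr2 bV ebx) exy.
by have := bigraph_stable2 G yV cV; rewrite -zc eyz.
Qed.

End Bigraph.

Lemma bigraph_sq_card (T : finType) (e : rel T) (V1 V2 : {set T}) (s : nat) :
  2 < s -> is_bigraph e V1 V2 (s ^ 2) s 3 ->
  #|V2| = s * #|V1| /\ #|V1| <= s ^ 2 - 2.
Proof.
move=> s_gt2 G.
have deg1 : {in V1, forall x, \sum_(b in V2) e x b = s ^ 2}.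
  move=> x xV; rewrite -(bigraph_degree1 G xV).
  apply: degree_sum (bigraph_cover G) _ => y.
  exact: (bigraph_stable1 G).
have deg2 : {in V2, forall b, \sum_(x in V1) e x b = s}.
  move=> b bV; rewrite -[RHS](bigraph_degree2 G bV).
  under eq_bigr do rewrite (bigraph_sym G).
  apply: (@degree_sum _ _ V2); first by rewrite setUC (bigraph_cover G).
  by move=> y; apply: (bigraph_stable2 G).
split; first exact: card_blocks deg1 deg2 (ltnW (ltnW s_gt2)).
exact: card_points_intersecting_ub deg1 deg2 (bigraph_common_nbr G s_gt2) s_gt2.
Qed.

(** Here the gcd is [s], so [rho = s] and [sigma = 1]; dividing [1 + s * (s ^ 2 - 1)] by [s] leaves
    remainder 1. *)
Lemma moore_bound3_sq (s : nat) :
  1 < s -> moore_bound3 (s ^ 2) s = (s ^ 2 - 1) * (s + 1).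
Proof.
move=> s_gt1; have s_gt0 : 0 < s by lia.
rewrite /moore_bound3 -mulnn gcdnC gcdnMl mulnK // divnn s_gt0 (addnC 1).
by rewrite [s * _]mulnC divnMDl // divn_small // addn0.
Qed.

Theorem proposition1p2 (s : nat) (hs : 3 <= s) :
  moore_bound3 (s ^ 2) s = (s ^ 2 - 1) + (s ^ 3 - s) /\
  (forall (T : finType) (e : rel T) (V1 V2 : {set T}),
     is_bigraph e V1 V2 (s ^ 2) s 3 ->
     #|T| <> moore_bound3 (s ^ 2) s) /\
  (forall (T : finType) (e : rel T) (V1 V2 : {set T}),
     is_bigraph e V1 V2 (s ^ 2) s 3 ->
     #|T| <= improved_moore_bound3 s) /\
  improved_moore_bound3 s = (s ^ 2 - 2) + (s ^ 3 - 2 * s) /\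
  (forall (T : finType) (e : rel T) (V1 V2 : {set T}),
     is_bigraph e V1 V2 (s ^ 2) s 3 ->
     #|T| = improved_moore_bound3 s ->
     #|V1| = s ^ 2 - 2 /\ #|V2| = s ^ 3 - 2 * s).
Proof.
have s2_ge9 : 9 <= s ^ 2 by rewrite -(leq_exp2r _ _ (isT : 0 < 2)) in hs.
have orderE (T : finType) (e : rel T) (V1 V2 : {set T}) :
    is_bigraph e V1 V2 (s ^ 2) s 3 -> #|T| = #|V1| * (s + 1).
  move=> G; rewrite (bigraph_card G) (proj1 (bigraph_sq_card hs G)).
  by rewrite mulnC -mulnS addn1.
have bound (T : finType) (e : rel T) (V1 V2 : {set T}) :
    is_bigraph e V1 V2 (s ^ 2) s 3 -> #|T| <= improved_moore_bound3 s.
  move=> G; rewrite (orderE _ _ _ _ G) leq_mul2r.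
  by rewrite (proj2 (bigraph_sq_card hs G)) orbT.
have mooreE := moore_bound3_sq (ltnW hs).
split; first by rewrite mooreE mulnDr muln1 mulnBl mul1n -expnSr addnC.
split.
  move=> T e V1 V2 /bound T_le TE; move: T_le.
  by rewrite TE mooreE leq_mul2r; lia.
split; first exact: bound.
split; first by rewrite /improved_moore_bound3 mulnDr muln1 mulnBl -expnSr addnC.
(* Both orders are multiples of [s + 1], and cancelling it determines [#|V1|]. *)
move=> T e V1 V2 G; rewrite (orderE _ _ _ _ G) => /eqP.
rewrite eqn_mul2r addn1 /= => /eqP V1E; split=> //.
by rewrite (proj1 (bigraph_sq_card hs G)) V1E mulnBr -expnS [s * 2]mulnC.
Qed.
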